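(* Let $q, m$ be nonnegative integers with $0 \leqslant m \leqslant q-2$, let $i \in \{1,3\}$, and let $n = 4q+i$ and $k = 2q + 2m + i - 1$. Let $h = \frac{n-k-1}{2}$ (so $h = q - m$). If $h \mid n$, then $$rn_k(C_n) = \mathrm{LB}(n,k) + \frac{h-1}{2},$$ where $\mathrm{LB}(n,k) = \left\lceil \frac{3k+3-n}{2}\right\rceil \cdot \frac{n-1}{2}$.
   Context: $C_n$ is the cycle on vertex set $\mathbb{Z}_n$, with $u,v$ adjacent iff $u \equiv v \pm 1 \pmod n$; $d(u,v)$ is the graph distance. A radio-$k$-labeling of a graph $G$ is a function $f \colon V(G) \to \{0,1,2,\ldots\}$ with $|f(u)-f(v)| \geqslant k - d(u,v) + 1$ for all distinct $u,v$. The span of $f$ is $\max\{|f(u)-f(v)|\}$, and $rn_k(G)$ is the minimum span over radio-$k$-labelings of $G$. *)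

(* Defs.v *)
From mathcomp Require Import all_boot all_order all_algebra boolp.
Set Implicit Arguments.
Unset Strict Implicit.
Unset Printing Implicit Defensive.
Import Order.TTheory GRing.Theory Num.Theory.
Local Open Scope ring_scope.

(* Adjacency in C_n, on the vertex set 'I_n read modulo n; the second disjunct
   is u = v - 1 mod n, written without truncated subtraction. *)
Definition cycle_adj (n : nat) : rel 'I_n := fun u v =>
  ((u == v + 1 %[mod n]) || (u + 1 == v %[mod n]))%N.

(* The least length of an e-walk from u to v. A shortest walk has fewer than
   #|T| edges; #|T| is returned when v is unreachable from u. *)
Definition gdist (T : finType) (e : rel T) (u v : T) : nat :=
  find (fun l => [exists p : l.-tuple T, path e u p && (last u p == v)])
       (iota 0 #|T|).

Definition radio_labeling (T : finType) (e : rel T) (k : nat) (f : T -> nat) :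
    Prop :=
  forall u v : T, u != v ->
    k%:Z - (gdist e u v)%:Z + 1 <= `|(f u)%:Z - (f v)%:Z|.

Definition label_span (T : finType) (f : T -> nat) : nat :=
  (\max_(u : T) \max_(v : T) `|f u - f v|)%N.

Definition is_radio_span (T : finType) (e : rel T) (k s : nat) : Prop :=
  exists2 f : T -> nat, radio_labeling e k f & label_span f = s.

Lemma radio_span_ex (T : finType) (e : rel T) (k : nat) :
  exists s, `[< is_radio_span e k s >].
Proof.
pose f (u : T) := (k.+1 * enum_rank u)%N.
exists (label_span f); apply/asboolP; exists f => // u v uv.
have le1 : (1 <= `|(enum_rank u : nat)%:Z - (enum_rank v : nat)%:Z|)%R.
  rewrite -gtz0_ge1 normr_gt0 subr_eq0; apply: contra uv => /eqP[E].
  by apply/eqP/enum_rank_inj/val_inj.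
rewrite /f !PoszM -mulrBr normrM.
apply: (@le_trans _ _ (k.+1)%:Z); last by rewrite ler_peMr.
by rewrite -addn1 PoszD lerD2r gerBl.
Qed.

Definition radio_number (T : finType) (e : rel T) (k : nat) : nat :=
  ex_minn (radio_span_ex e k).

Definition LB (n k : nat) : rat :=
  (Num.ceil ((3 * k%:R + 3 - n%:R) / 2 : rat))%:~R * ((n%:R - 1) / 2).

(* Main.v *)
Require Import Defs.
From mathcomp Require Import all_boot all_order all_algebra boolp.
From mathcomp Require Import zify lra.
Set Implicit Arguments.
Unset Strict Implicit.
Unset Printing Implicit Defensive.
Import Order.TTheory GRing.Theory Num.Theory.
Local Open Scope ring_scope.

(* Put R = (h-1)/2, n = h s, T = (n-1)/2, phi = (3k+3-n)/2, so phi + h = k + 1.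

   Lower bound: list the vertices as x_0, ..., x_(n-1) by increasing label. Three
   vertices have pairwise distances summing to at most n, so the labels of x_j
   and x_(j+2) differ by at least phi, and if they differ by exactly phi then
   d(x_j, x_(j+2)) = h, whence x_j = x_(j+2) mod h. The T + 1 = R s + (s+1)/2
   even-indexed vertices meet at least R + 1 classes mod h, of s vertices each,
   so at least R of the T two-step gaps exceed phi.

   Upper bound: x_(2t) = t h + t/s (floor division) runs through the classes
   0, ..., R mod h one after the other, the last one only half-way, and
   x_(2t+1) = x_(2t) - a_t, where a_t = T during the first R classes and
   a_t = T - R in the last one. *)

(** * Graph distance by walks *)

Section GraphDistance.
Variables (T : finType) (e : rel T).

Lemma gdist_le (u v : T) (p : seq T) :
  path e u p -> last u p = v -> (size p < #|T|)%N ->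
  (gdist e u v <= size p)%N.
Proof.
move=> pp lp sp; rewrite /gdist leqNgt; apply/negP => lt.
have := before_find 0%N lt; rewrite nth_iota // add0n => /negbT/negP; apply => /=.
by apply/existsP; exists (in_tuple p); rewrite pp lp eqxx.
Qed.

Lemma gdist_path (u v : T) : (gdist e u v < #|T|)%N ->
  exists p : seq T, [/\ path e u p, last u p = v & size p = gdist e u v].
Proof.
move=> lt; have has_p : has (fun l => [exists p : l.-tuple T,
    path e u p && (last u p == v)]) (iota 0 #|T|).
  by rewrite has_find size_iota.
have := nth_find 0%N has_p; rewrite nth_iota // add0n /=.
case/existsP => p /andP[pp /eqP lp]; exists p; split=> //.
by rewrite size_tuple.
Qed.

End GraphDistance.

(** * Distance in the cycle, and radio labelings expressed through it *)

Section CycleDistance.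
Local Open Scope nat_scope.

(** With truncated subtraction one of [u - v], [v - u] vanishes, so their sum is the absolute
    difference. The formula is meant for representatives below [n]. *)
Definition circ_dist (n u v : nat) : nat :=
  minn ((u - v) + (v - u)) (n - ((u - v) + (v - u))).

Lemma circ_distC n u v : circ_dist n u v = circ_dist n v u.
Proof. by rewrite /circ_dist addnC. Qed.

Lemma circ_dist_triangle n u v w : u < n -> v < n -> w < n ->
  circ_dist n u w <= circ_dist n u v + circ_dist n v w.
Proof. rewrite /circ_dist; lia. Qed.

Lemma circ_dist_perimeter n u v w : u < n -> v < n -> w < n ->
  circ_dist n u v + circ_dist n v w + circ_dist n u w <= n.
Proof. rewrite /circ_dist; lia. Qed.

Lemma circ_dist_mod n u v d : 0 < n -> 2 * d <= n ->
  u + d = v %[mod n] -> circ_dist n (u %% n) (v %% n) = d.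
Proof.
move=> n0 dn; rewrite -modnDml => E.
have un : u %% n < n by rewrite ltn_mod.
have vn : v %% n < n by rewrite ltn_mod.
move: E; case: (ltnP (u %% n + d) n) => ud.
  by rewrite modn_small // => <-; rewrite /circ_dist; lia.
rewrite -(subnK ud) modnDr modn_small; last by lia.
by move=> <-; rewrite /circ_dist; lia.
Qed.

Lemma cycle_adj_circ_dist n (u v : 'I_n) :
  cycle_adj u v -> circ_dist n u v <= 1.
Proof.
have := ltn_ord u; have := ltn_ord v => vn un.
have step (x y : nat) : x < n -> y < n -> x = y + 1 %[mod n] ->
    x = y + 1 \/ x = 0 /\ y + 1 = n.
  move=> xn yn; rewrite modn_small //; case: (ltnP (y + 1) n) => yn1.
    by rewrite modn_small //; left.
  have -> : y + 1 = n by lia.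
  by rewrite modnn; right; lia.
by case/orP => /eqP E; [have := step u v un vn E | have := step v u vn un (esym E)];
  rewrite /circ_dist; lia.
Qed.

Lemma circ_dist_path n (u : 'I_n) (p : seq 'I_n) :
  path (@cycle_adj n) u p -> circ_dist n u (last u p) <= size p.
Proof.
elim: p u => [|w p IHp] u /=; first by rewrite /circ_dist; lia.
case/andP => /cycle_adj_circ_dist uw /IHp wl.
have := circ_dist_triangle (ltn_ord u) (ltn_ord w) (ltn_ord (last w p)).
by lia.
Qed.

Lemma cycle_walk_up n (l : nat) (u v : 'I_n) : u + l = v %[mod n] ->
  exists p : seq 'I_n, [/\ path (@cycle_adj n) u p, last u p = v & size p = l].
Proof.
elim: l u => [|l IHl] u E.
  exists [::]; split=> //=; apply: val_inj.
  by move: E; rewrite addn0 !modn_small.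
have n0 : 0 < n by apply: leq_ltn_trans (ltn_ord u).
have wn : (u + 1) %% n < n by rewrite ltn_mod.
have [|p [pp lp sp]] := IHl (Ordinal wn).
  by rewrite /= modnDml -E; congr (_ %% _); lia.
exists (Ordinal wn :: p); rewrite /= lp sp pp andbT; split=> //.
by apply/orP; right; rewrite /= modn_mod.
Qed.

Lemma cycle_walk_down n (l : nat) (u v : 'I_n) : v + l = u %[mod n] ->
  exists p : seq 'I_n, [/\ path (@cycle_adj n) u p, last u p = v & size p = l].
Proof.
elim: l v => [|l IHl] v E.
  exists [::]; split=> //=; apply: val_inj.
  by move: E; rewrite addn0 !modn_small.
have n0 : 0 < n by apply: leq_ltn_trans (ltn_ord u).
have wn : (v + 1) %% n < n by rewrite ltn_mod.
have [|p [pp lp sp]] := IHl (Ordinal wn).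
  by rewrite /= modnDml -E; congr (_ %% _); lia.
exists (rcons p v); rewrite rcons_path last_rcons size_rcons lp sp pp.
by split=> //; apply/orP; left; rewrite /= modn_mod.
Qed.

Lemma gdist_cycle n (u v : 'I_n) : gdist (@cycle_adj n) u v = circ_dist n u v.
Proof.
have un := ltn_ord u; have vn := ltn_ord v.
have [p [pp lp sp]] : exists p : seq 'I_n,
    [/\ path (@cycle_adj n) u p, last u p = v & size p = circ_dist n u v].
  (* The shorter arc goes up or down, and passes 0 or not. *)
  have : [|| u + circ_dist n u v == v, u + circ_dist n u v == v + n,
          v + circ_dist n u v == u | v + circ_dist n u v == u + n].
    by rewrite /circ_dist; lia.
  case/or4P => /eqP E; [apply: cycle_walk_up|apply: cycle_walk_up|
    apply: cycle_walk_down|apply: cycle_walk_down]; by rewrite E ?modnDr.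
have dn : circ_dist n u v < n by rewrite /circ_dist; lia.
have le : gdist (@cycle_adj n) u v <= circ_dist n u v.
  by rewrite -sp; apply: gdist_le => //; rewrite sp card_ord.
apply/eqP; rewrite eqn_leq le.
have [|p' [pp' lp' <-]] := @gdist_path _ (@cycle_adj n) u v.
  by rewrite card_ord; apply: leq_ltn_trans dn.
by rewrite -{1}lp'; apply: circ_dist_path.
Qed.

Lemma radio_labeling_cycleP n k (f : 'I_n -> nat) :
  radio_labeling (@cycle_adj n) k f <->
  (forall u v : 'I_n, u != v -> f u <= f v -> k.+1 + f u <= f v + circ_dist n u v).
Proof.
split=> H u v uv.
  by move: (H u v uv); rewrite gdist_cycle => {H} H1 H2; lia.
rewrite gdist_cycle; case: (leqP (f u) (f v)) => fuv.
  by have := H u v uv fuv; lia.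
by have := H v u; rewrite eq_sym uv circ_distC => /(_ isT (ltnW fuv)); lia.
Qed.

Lemma label_span_ge (T : finType) (f : T -> nat) u v : f v - f u <= label_span f.
Proof.
apply: leq_trans (leq_bigmax (F := fun u => \max_(v : T) `|f u - f v|) v).
by apply: leq_trans (leq_bigmax (F := fun w => `|f v - f w|) u); lia.
Qed.

Lemma label_span_le (T : finType) (f : T -> nat) B :
  (forall u, f u <= B) -> label_span f <= B.
Proof.
move=> fB; apply/bigmax_leqP => u _; apply/bigmax_leqP => v _.
by have := fB u; have := fB v; lia.
Qed.

Lemma radio_number_le (T : finType) (e : rel T) k (f : T -> nat) :
  radio_labeling e k f -> radio_number e k <= label_span f.
Proof.
move=> rf; rewrite /radio_number; case: ex_minnP => s _; apply.
by apply/asboolP; exists f.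
Qed.

Lemma radio_number_attained (T : finType) (e : rel T) k :
  exists2 f : T -> nat, radio_labeling e k f & label_span f = radio_number e k.
Proof. by rewrite /radio_number; case: ex_minnP => s /asboolP. Qed.

End CycleDistance.

(** * Lower bound: two-step gaps and residue classes mod [h] *)

Section LowerBound.
Local Open Scope nat_scope.

Lemma circ_dist_dvd_modn n h u v : u < n -> v < n -> h %| n ->
  circ_dist n u v = h -> u = v %[mod h].
Proof.
move=> un vn /dvdnP[s ns] E.
have : [|| u == v + h, v == u + h, u + h == v + n | v + h == u + n].
  by move: E; rewrite /circ_dist; lia.
rewrite ns => /or4P[] /eqP E'; rewrite ?E' ?modnDr //.
  by rewrite -[u %% h]modnDr E' addnC modnMDl.
by rewrite -[v %% h]modnDr E' addnC modnMDl.
Qed.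

(** Division by [h] sends [v] injectively to a residue that occurs and a quotient below [s]. *)
Lemma uniq_size_residues h s (l : seq nat) : uniq l ->
  {in l, forall v, v < h * s} ->
  size l <= size (undup [seq v %% h | v <- l]) * s.
Proof.
move=> ul ltl; set res := undup _.
pose P := [seq (r, q) | r <- res, q <- iota 0 s].
have <- : size P = size res * s by rewrite size_allpairs size_iota.
rewrite -(size_map (fun v => (v %% h, v %/ h))).
apply: uniq_leq_size.
  rewrite map_inj_uniq // => u v [E1 E2].
  by rewrite (divn_eq u h) (divn_eq v h) E1 E2.
move=> _ /mapP[v vl ->]; apply/allpairsP; exists (v %% h, v %/ h); split=> //=.
  by rewrite mem_undup; apply: map_f.
have vn := ltl _ vl; have h0 : 0 < h by move: vn; case: (h).
by rewrite mem_iota add0n ltn_divLR // mulnC.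
Qed.

Lemma sorted_enumeration (T : finType) (f : T -> nat) (x0 : T) :
  exists x : nat -> T, [/\
    forall i j, i < #|T| -> j < #|T| -> x i = x j -> i = j &
    forall i j, i <= j -> j < #|T| -> f (x i) <= f (x j)].
Proof.
pose le := [rel u v | f u <= f v].
have le_total : total le by move=> u v /=; apply: leq_total.
have le_trans : transitive le by move=> v u w /=; apply: leq_trans.
pose l := sort le (enum T).
have sl : size l = #|T| by rewrite size_sort -cardE.
exists (nth x0 l); split=> [i j iT jT E | i j ij jT].
  by apply/eqP; rewrite -(nth_uniq x0 _ _ (_ : uniq l)) ?sl ?E //
    ?sort_uniq ?enum_uniq.
apply: (sorted_leq_nth (leT := le)) => //; rewrite ?inE ?sl //.
- by move=> u /=.
- exact: sort_sorted.
exact: leq_ltn_trans jT.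
Qed.

Variables (n k phi h : nat).
Hypothesis phi_eq : 2 * phi + n = 3 * k.+1.
Hypothesis h_eq : phi + h = k.+1.

(** Adding the three radio conditions gives twice the gap at least [3 * k.+1 - n], which is
    [2 * phi]. If the gap is exactly [phi], the condition on [u], [w] forces distance at least [h],
    while the other two and the perimeter bound force at most [h]. *)
Lemma two_step_gap (f : 'I_n -> nat) (u v w : 'I_n) :
  radio_labeling (@cycle_adj n) k f -> u != v -> v != w -> u != w ->
  f u <= f v -> f v <= f w ->
  f u + phi <= f w /\ (f w = f u + phi -> circ_dist n u w = h).
Proof.
move=> /radio_labeling_cycleP rf uv vw uw fuv fvw.
have := circ_dist_perimeter (ltn_ord u) (ltn_ord v) (ltn_ord w).
have := rf _ _ uv fuv; have := rf _ _ vw fvw.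
have := rf _ _ uw (leq_trans fuv fvw).
by split; lia.
Qed.

(** Every class mod [h] met for the first time costs one unit beyond [phi]; the initial class is
    free, hence the successor on the right. The list is reversed so that the newest vertex is its
    head, where [undup] tests it against all earlier ones. *)
Lemma even_labels_lower (f : 'I_n -> nat) (x : nat -> 'I_n) (t : nat) :
  h %| n -> radio_labeling (@cycle_adj n) k f ->
  (forall i j, i < n -> j < n -> x i = x j -> i = j) ->
  (forall i j, i <= j -> j < n -> f (x i) <= f (x j)) ->
  2 * t < n ->
  t * phi + size (undup [seq x (2 * i) %% h | i <- rev (iota 0 t.+1)])
    + f (x 0) <= (f (x (2 * t))).+1.
Proof.
move=> hn rf xinj xmon; elim: t => [|t IHt] tn; first by rewrite /= muln0; lia.
have neq i j : i < j -> j < n -> x i != x j.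
  by move=> ij jn; apply/eqP => E; have := xinj _ _ (ltn_trans ij jn) jn E; lia.
have {}IHt := IHt ltac:(lia).
rewrite -(addn1 t.+1) iotaD add0n rev_cat map_cat /=.
set l := [seq _ | i <- rev (iota 0 t.+1)] in IHt *.
have [] := @two_step_gap f (x (2 * t)) (x (2 * t).+1) (x (2 * t).+2) rf.
- by apply: neq; lia.
- by apply: neq; lia.
- by apply: neq; lia.
- by apply: xmon; lia.
- by apply: xmon; lia.
have -> : (2 * t).+2 = 2 * t.+1 by lia.
move=> gap tight.
rewrite mulSn; case: ifP => [_|/negbT new] /=; move: (size _) IHt => c IHt.
  by lia.
suff : f (x (2 * t.+1)) <> f (x (2 * t)) + phi by lia.
move=> /tight /(circ_dist_dvd_modn (ltn_ord _) (ltn_ord _) hn) E.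
case/negP: new; rewrite -E; apply: (map_f (fun i => x (2 * i) %% h)).
by rewrite mem_rev mem_iota; lia.
Qed.

Lemma cycle_span_lower (R S : nat) (f : 'I_n -> nat) :
  h = 2 * R + 1 -> n = h * (2 * S + 1) ->
  radio_labeling (@cycle_adj n) k f ->
  phi * (h * S + R) + R <= label_span f.
Proof.
move=> hR nS rf; have n0 : 0 < n by rewrite nS; lia.
have [x [xinj xmon]] := sorted_enumeration f (Ordinal n0).
rewrite card_ord in xinj xmon.
have nT : n = 2 * (h * S + R) + 1 by nia.
set T := h * S + R in nT *.
pose l := [seq nat_of_ord (x (2 * i)) | i <- rev (iota 0 T.+1)].
have H := @even_labels_lower f x T _ rf xinj xmon.
rewrite {1}nS dvdn_mulr // in H; have {}H := H isT ltac:(lia).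
have ul : uniq l.
  rewrite map_inj_in_uniq ?rev_uniq ?iota_uniq // => i j.
  rewrite !mem_rev !mem_iota => iT jT /val_inj E.
  by have := xinj _ _ _ _ E; lia.
have := uniq_size_residues (h := h) (s := 2 * S + 1) ul.
rewrite {1 2}/l size_map size_rev size_iota -nS -map_comp => card_res.
have {}card_res : T.+1 <= size (undup
    [seq x (2 * i) %% h | i <- rev (iota 0 T.+1)]) * (2 * S + 1).
  by apply: card_res => v /mapP[i _ ->].
have := label_span_ge f (x 0) (x (2 * T)).
move: (size _) H card_res => c H card_res.
(* [R] classes hold only [R * (2 * S + 1)] vertices, which is [T - S], fewer than the [T.+1]
   listed. *)
have : R < c by rewrite ltnNge; apply/negP; rewrite /T hR in card_res *; nia.
lia.
Qed.

End LowerBound.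

(** * Upper bound: an explicit labeling *)

Section UpperBound.
Local Open Scope nat_scope.

(* Three-step gaps follow from the equality for two-step gaps and the triangle
   inequality; from four steps on, the labels alone differ by 2 phi > k. *)
Lemma radio_condition_short_steps (N k phi h : nat) (d : nat -> nat -> nat)
    (g : nat -> nat) :
  (forall i j l, i < N -> j < N -> l < N -> d i l <= d i j + d j l) ->
  (forall i j, d i j = d j i) ->
  phi + h = k.+1 -> h <= phi ->
  (forall j, j.+1 < N -> g j <= g j.+1) ->
  (forall j, j.+1 < N -> k.+1 + g j <= g j.+1 + d j j.+1) ->
  (forall j, j.+2 < N -> g j.+2 + h = g j + phi + d j j.+2 /\ h <= d j j.+2) ->
  forall i j, i < j -> j < N -> k.+1 + g i <= g j + d i j.
Proof.
move=> tri sym hk hphi mon step1 step2 i j ij jN.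
have far e : i + 4 + e < N -> g i + 2 * phi <= g (i + 4 + e).
  elim: e => [|e IHe] eN.
    have := step2 i; have := step2 i.+2.
    have -> : i + 4 + 0 = i.+4 by lia.
    lia.
  have := IHe ltac:(lia); have := mon (i + 4 + e) ltac:(lia).
  have -> : i + 4 + e.+1 = (i + 4 + e).+1 by lia.
  lia.
have [e ej] : exists e, j = i.+1 + e by exists (j - i.+1); lia.
case: e ej => [|[|[|e]]] ej.
- by rewrite ej addn0; apply: step1; lia.
- have -> : j = i.+2 by lia.
  by have := step2 i; lia.
- have -> : j = i.+3 by lia.
  have := step2 i.+1; have := step1 i.
  have := tri i i.+3 i.+1; rewrite (sym i.+3 i.+1).
  lia.
- have -> : j = i + 4 + e by lia.
  by have := far e; lia.
Qed.

(** An injective order of [n] positions is a bijection onto the vertices, so labels given by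
    position transport to vertices through [invF]. *)
Lemma cycle_span_upper (n k : nat) (P g : nat -> nat) :
  0 < n ->
  (forall i j, i < n -> j < n -> P i = P j %[mod n] -> i = j) ->
  (forall i j, i <= j -> j < n -> g i <= g j) ->
  (forall i j, i < j -> j < n ->
     k.+1 + g i <= g j + circ_dist n (P i %% n) (P j %% n)) ->
  radio_number (@cycle_adj n) k <= g n.-1.
Proof.
move=> n0 Pinj gmon rad.
pose x (i : 'I_n) := Ordinal (ltn_pmod (P i) n0).
have xinj : injective x.
  by move=> i j /(congr1 val) E; apply: val_inj; apply: Pinj E.
pose f u := g (invF xinj u).
have rf : radio_labeling (@cycle_adj n) k f.
  apply/radio_labeling_cycleP => u v.
  rewrite -(f_invF xinj u) -(f_invF xinj v) /f !invF_f.
  move: (invF _ u) (invF _ v) => i j ij fij /=.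
  case: (ltngtP i j) => [lt|lt|E].
  - exact: rad.
  - have := rad _ _ lt (ltn_ord i); rewrite circ_distC.
    by have := gmon _ _ (ltnW lt) (ltn_ord i); lia.
  - by case/eqP: ij; rewrite (val_inj E).
apply: leq_trans (radio_number_le rf) _; apply: label_span_le => u.
by apply: gmon; have := ltn_ord (invF xinj u); lia.
Qed.

Variables (R S h s n T phi k : nat).
Hypothesis h_def : h = 2 * R + 1.
Hypothesis s_def : s = 2 * S + 1.
Hypothesis T_def : T = R * s + S.
Hypothesis n_def : n = 2 * T + 1.
Hypothesis n_k : n = 2 * h + k.+1.
Hypothesis phi_h : phi + h = k.+1.
Hypothesis S_ge2 : 2 <= S.

Let r t := t %/ s.
(** Since [n - T = h * S + R.+1], the odd-indexed partners of classes 0, ..., [R - 1] lie in classes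
    [R + 1], ..., [2 * R]. For class [R] the same shift would return to class 0; as
    [n - (T - R) = h * S.+1], the smaller value keeps the partner in class [R], in the half left
    free. *)
Let a t := if r t < R then T else T - R.
(** Positions are not reduced mod [n]; adding [n - a] stands for stepping back by [a]. *)
Let pos j := j./2 * h + r j./2 + (if odd j then n - a j./2 else 0).
(** The odd term makes the radio condition with the preceding even vertex, at distance [a], an
    equality. *)
Let label j := j./2 * phi + r j./2 + (if odd j then k.+1 - a j./2 else 0).

Let n_hs : n = h * s.
Proof. by rewrite n_def T_def h_def s_def; lia. Qed.

(** This is where [S_ge2] enters: it yields [h <= phi], keeps [k.+1 - a t] from truncating, and
    keeps the two-step distances below half the cycle. *)
Let Th : 2 * h + R <= T.
Proof.
have : h * 2 <= h * S by rewrite leq_mul2l S_ge2 orbT.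
by rewrite T_def s_def h_def; lia.
Qed.

Let rS t : r t.+1 = r t \/ r t.+1 = (r t).+1.
Proof.
rewrite /r divnS; last by lia.
by case: (s %| t.+1); [right|left].
Qed.

Let rR t : t <= T -> r t <= R.
Proof. by move=> tT; rewrite /r -ltnS ltn_divLR; lia. Qed.

Let aS t : T - R <= a t.+1 <= a t /\ a t <= T.
Proof. by rewrite /a; have := rS t; case: ifP; case: ifP; lia. Qed.

Let pos_even t : pos (2 * t) = t * h + r t.
Proof. by rewrite /pos mul2n odd_double doubleK addn0. Qed.
Let pos_odd t : pos (2 * t).+1 = t * h + r t + (n - a t).
Proof. by rewrite /pos mul2n /= odd_double uphalf_double. Qed.
Let label_even t : label (2 * t) = t * phi + r t.
Proof. by rewrite /label mul2n odd_double doubleK addn0. Qed.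
Let label_odd t : label (2 * t).+1 = t * phi + r t + (k.+1 - a t).
Proof. by rewrite /label mul2n /= odd_double uphalf_double. Qed.

Let parity j : exists t, j = 2 * t \/ j = (2 * t).+1.
Proof. by exists j./2; lia. Qed.

Let circ_dist_pos i j d e : 2 * d <= n ->
  pos i + d = pos j + e * n \/ pos j + d = pos i + e * n ->
  circ_dist n (pos i %% n) (pos j %% n) = d.
Proof.
move=> dn E; case: E => E; last rewrite circ_distC; apply: circ_dist_mod => //;
  by rewrite ?E 1?addnC ?modnMDl //; lia.
Qed.

Let step1 j : j.+1 < n ->
  label j <= label j.+1 /\
  k.+1 + label j <= label j.+1 + circ_dist n (pos j %% n) (pos j.+1 %% n).
Proof.
case: (parity j) => t [] -> jn; have := aS t => at_bounds.
  rewrite (@circ_dist_pos _ _ (a t) 1) ?label_even ?label_odd ?pos_even ?pos_odd;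
    lia.
have -> : (2 * t).+2 = 2 * t.+1 by lia.
have := rS t => rt.
rewrite (@circ_dist_pos _ _ (n - h - (r t.+1 - r t) - a t) 0);
  rewrite ?label_even ?label_odd ?pos_even ?pos_odd ?mulSn; lia.
Qed.

Let step2 j : j.+2 < n ->
  label j.+2 + h = label j + phi + circ_dist n (pos j %% n) (pos j.+2 %% n)
  /\ h <= circ_dist n (pos j %% n) (pos j.+2 %% n).
Proof.
case: (parity j) => t [] -> jn; have := rS t; have := aS t => at_bounds rt.
  have -> : (2 * t).+2 = 2 * t.+1 by lia.
  rewrite (@circ_dist_pos _ _ (h + (r t.+1 - r t)) 0);
    rewrite ?label_even ?label_odd ?pos_even ?pos_odd ?mulSn; lia.
have -> : (2 * t).+3 = (2 * t.+1).+1 by lia.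
rewrite (@circ_dist_pos _ _ (h + (r t.+1 - r t) + (a t - a t.+1)) 0);
  rewrite ?label_even ?label_odd ?pos_even ?pos_odd ?mulSn; lia.
Qed.

(* Inverse of j |-> pos j %% n: even-indexed vertices have residue at most R mod
   h, odd-indexed ones at least R, and the class R is split between q <= S and
   q > S. *)
Let index_of v :=
  let q := v %/ h in let rho := v %% h in
  if (rho < R) || (rho == R) && (q <= S) then 2 * (rho * s + q)
  else if rho == R then (2 * (R * s + (q - S.+1))).+1
  else (2 * ((rho - R.+1) * s + (q + S.+1) %% s)).+1.

Let index_of_pos j : j < n -> index_of (pos j %% n) = j.
Proof.
have digits c q rho : pos j = c * n + (q * h + rho) -> q < s -> rho < h ->
    (pos j %% n) %/ h = q /\ (pos j %% n) %% h = rho.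
  move=> -> qs rhoh; have lt : q * h + rho < n.
    have : q.+1 * h <= s * h by rewrite leq_mul2r qs orbT.
    by rewrite n_hs (mulnC h) mulSn; lia.
  rewrite modnMDl modn_small // modnMDl divnMDl ?modn_small //; last by lia.
  by rewrite divn_small ?addn0.
have s0 : 0 < s by lia.
have sE : S + S.+1 = s by lia.
have gtR x : ((x + R.+1 < R) = false) * ((x + R.+1 == R) = false).
  by split; lia.
case: (parity j) => t [] jE jn.
  have tE := divn_eq t s; have ts : t %% s < s by rewrite ltn_mod.
  have rT : r t <= R by apply: rR; lia.
  have [||| qE rhoE] := digits (r t) (t %% s) (r t) => //.
  - by rewrite jE pos_even n_hs {1}tE -/(r t); lia.
  - by lia.
  rewrite /index_of qE rhoE; case: ifP => [_|/negbT]; first by rewrite -tE.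
  rewrite -/(r t) in tE.
  (* In class [R], [t <= T = R * s + S] bounds the quotient by [S], so the even branch is chosen. *)
  have [E|] : r t = R \/ r t < R by lia.
    by rewrite E in tE *; lia.
  by move=> ->.
have tE := divn_eq t s; have ts : t %% s < s by rewrite ltn_mod.
have rT : r t <= R by apply: rR; lia.
have nT : n - T = h * S + R.+1 by rewrite n_def T_def s_def h_def; lia.
have nTR : n - (T - R) = h * S.+1 by rewrite n_def T_def s_def h_def; lia.
case: (ltnP (r t) R) => rtR.
  have qE := divn_eq (t %% s + S) s.
  (* The quotient [t %% s + S] may reach [s]; its carry is a full turn, absorbed by the multiple of
     [n]. *)
  have [||| qE' rhoE] := digits (r t + (t %% s + S) %/ s) ((t %% s + S) %% s)
    (r t + R.+1) => //.
  - have : t * h = r t * n + t %% s * h by rewrite {1}tE -/(r t) n_hs; lia.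
    have : (t %% s + S) * h
        = (t %% s + S) %/ s * n + (t %% s + S) %% s * h.
      by rewrite {1}qE n_hs; lia.
    by rewrite jE pos_odd /a rtR nT !mulnDl; lia.
  - by rewrite ltn_mod.
  - by lia.
  (* Adding [S.+1] undoes the shift by [S] modulo [s], because [S + S.+1 = s]. *)
  rewrite /index_of qE' rhoE !gtR addnK /= (modnDml (_ + S)) -addnA sE.
  by rewrite modnDr modn_mod -tE.
have rtE : r t = R by lia.
rewrite -/(r t) rtE in tE.
have [||| qE rhoE] := digits R (t %% s + S.+1) R => //.
- by rewrite jE pos_odd /a rtE ltnn nTR {1}tE n_hs; lia.
- by lia.
- by lia.
rewrite /index_of qE rhoE ltnn eqxx /= ifN; last by lia.
by rewrite addnK -tE.
Qed.

Let pos_inj i j : i < n -> j < n -> pos i = pos j %[mod n] -> i = j.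
Proof. by move=> /index_of_pos iE /index_of_pos jE E; rewrite -iE E jE. Qed.

Lemma cycle_radio_number_upper :
  radio_number (@cycle_adj n) k <= phi * T + R.
Proof.
have n0 : 0 < n by lia.
have mon i j : i <= j -> j < n -> label i <= label j.
  elim: j => [|j IHj] ij jn; first by have -> : i = 0 by lia.
  case: (ltngtP i j.+1) ij => [lt _|//|-> //].
  by apply: leq_trans (IHj lt (ltnW jn)) _; case: (step1 jn).
have -> : phi * T + R = label n.-1.
  have -> : n.-1 = 2 * T by lia.
  rewrite label_even mulnC; congr (_ + _).
  by rewrite /r T_def divnMDl ?divn_small ?addn0 //; lia.
apply: (cycle_span_upper n0 pos_inj mon) => i j.
apply: (@radio_condition_short_steps n k phi h
  (fun i j => circ_dist n (pos i %% n) (pos j %% n)) label).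
- by move=> *; apply: circ_dist_triangle; rewrite ltn_mod.
- by move=> *; apply: circ_distC.
- exact: phi_h.
- by lia.
- by move=> l /step1[].
- by move=> l /step1[].
- exact: step2.
Qed.

End UpperBound.

(** * Parameters and the closed formula *)

Theorem theorem4p6 (q m i n k h : nat)
    (hm : (m + 2 <= q)%N)
    (hi : i = 1%N \/ i = 3%N)
    (hn : n = (4 * q + i)%N)
    (hk : k = (2 * q + 2 * m + i - 1)%N)
    (hh : h%:R = (n%:R - k%:R - 1) / 2 :> rat)
    (hdvd : (h %| n)%N) :
  (radio_number (@cycle_adj n) k)%:R = LB n k + (h%:R - 1) / 2 :> rat.
Proof.
have n_k : n = (2 * h + k.+1)%N.
  apply/eqP; rewrite -(eqr_nat rat) natrD natrM hh -[k.+1]addn1 natrD.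
  by apply/eqP; lra.
have [s n_hs] : exists s, n = (h * s)%N.
  by case/dvdnP: hdvd => s ->; exists s; rewrite mulnC.
have n_odd : odd n by rewrite hn; case: hi => ->; lia.
have [R h_def] : exists R, h = (2 * R + 1)%N.
  by exists h./2; move: n_odd; rewrite n_hs oddM => /andP[]; lia.
have [S s_def] : exists S, s = (2 * S + 1)%N.
  by exists s./2; move: n_odd; rewrite n_hs oddM => /andP[_]; lia.
have h_q : (h <= q)%N by lia.
(* Otherwise [s <= 3], so [n <= 3 * h <= 3 * q], against [n = 4 * q + i]. *)
have S_ge2 : (2 <= S)%N.
  rewrite ltnNge; apply/negP => S_le1.
  have : (h * s <= h * 3)%N by rewrite leq_mul2l s_def; lia.
  by rewrite -n_hs; lia.
(* [phi] is the value of [(3k + 3 - n) / 2], already an integer, so the ceiling in [LB] changes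
   nothing. *)
pose phi := (q + 3 * m + i)%N; pose T := (R * s + S)%N.
have n_T : n = (2 * T + 1)%N by rewrite n_hs /T h_def s_def; lia.
have phi_h : (phi + h = k.+1)%N by rewrite /phi; lia.
have -> : radio_number (@cycle_adj n) k = (phi * T + R)%N.
  apply/eqP; rewrite eqn_leq.
  rewrite (cycle_radio_number_upper h_def s_def erefl n_T n_k phi_h S_ge2) /=.
  have [f rf <-] := radio_number_attained (@cycle_adj n) k.
  have -> : T = (h * S + R)%N by rewrite /T h_def s_def; lia.
  by apply: (cycle_span_lower _ phi_h h_def _ rf); [rewrite /phi; lia | rewrite -s_def].
have -> : LB n k = phi%:R * T%:R.
  rewrite /LB; congr (_ * _); last by rewrite n_T natrD natrM; lra.
  have -> : (3 * k%:R + 3 - n%:R) / 2 = (Posz phi)%:~R :> rat.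
    have : ((2 * phi + n)%N%:R = (3 * k + 3)%N%:R :> rat).
      by congr _%:R; rewrite /phi; lia.
    by rewrite (natrD _ (2 * phi)) (natrD _ (3 * k)) !natrM -pmulrn; lra.
  by rewrite intrKceil.
by rewrite natrD natrM h_def natrD natrM; lra.
Qed.
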